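(* Let $a\ge 1$ and $m\ge 1$ be integers, and let $f_0$ be defined by $f_0(1)=1$, $f_0(2)=a$, and $f_0(n+2)=(a-1)f_0(n+1)$ for $n\ge 1$. Let $c_m(n,k)$ be the function associated with $f_0$ as in the context. Then, for $1\le k\le n$, the number $c_m(n,k)$ is the number of words of length $n-1$ over $\{0,1,\ldots,a-1,\ldots,m+a-1\}$ in which exactly $k-1$ letters equal $m+a-1$, and no two adjacent letters from $\{0,1,\ldots,a-1\}$ are identical.
   Context: For an arithmetic function $f_0$ defined on the positive integers, define recursively for $m\ge 1$ and $1\le k\le n$: $c_m(n,k)=\sum_{i_1+\cdots+i_k=n} f_{m-1}(i_1)\cdots f_{m-1}(i_k)$, the sum over positive integers $i_1,\ldots,i_k$, and $f_m(n)=\sum_{k=1}^n c_m(n,k)$. *)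

(* Defs.v *)
From mathcomp Require Import all_boot all_order all_algebra.

Set Implicit Arguments.
Unset Strict Implicit.
Unset Printing Implicit Defensive.

Import GRing.Theory.
Local Open Scope ring_scope.

(* Arithmetic functions are total functions on nat whose value at 0 is never
   used: every argument below is a positive part i_j or a positive n. *)

(* The sum of g(i_1)...g(i_k) over positive integers i_1 + ... + i_k = n.
   Each part is then at most n, so the parts are taken in 'I_n.+1. *)
Definition composition_sum (R : pzSemiRingType) (g : nat -> R) (n k : nat) : R :=
  \sum_(i : {ffun 'I_k -> 'I_n.+1} |
          [forall j, (0 < i j)%N] && ((\sum_(j < k) i j)%N == n))
     \prod_(j < k) g (i j).

Fixpoint f_ (R : pzSemiRingType) (f0 : nat -> R) (m : nat) : nat -> R :=
  if m is m'.+1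
  then fun n => \sum_(1 <= k < n.+1) composition_sum (f_ f0 m') n k
  else f0.

(* Meaningful for 1 <= m only; c_ f0 0 is a junk value equal to c_ f0 1. *)
Definition c_ (R : pzSemiRingType) (f0 : nat -> R) (m n k : nat) : R :=
  composition_sum (f_ f0 m.-1) n k.

(* [sorted e w] says that e holds between every two consecutive letters of w;
   no transitivity of e is involved. *)
Definition no_equal_adjacent_below (a q : nat) (w : seq 'I_q) : bool :=
  sorted (fun x y : 'I_q => ~~ [&& (x < a)%N, (y < a)%N & x == y]) w.

Definition words (a m n k : nat) : {set (n - 1).-tuple 'I_(m + a)} :=
  [set w : (n - 1).-tuple 'I_(m + a) |
     (count (fun x : 'I_(m + a) => x == (m + a - 1)%N :> nat) w == k - 1)%N
     && no_equal_adjacent_below a w].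

(* Main.v *)
Require Import Defs.
From mathcomp Require Import all_boot all_order all_algebra.

Set Implicit Arguments.
Unset Strict Implicit.
Unset Printing Implicit Defensive.

Import GRing.Theory.
Local Open Scope ring_scope.

(** Cutting a word over m + a letters at each occurrence of its top letter
    yields a sequence of k words over the remaining m - 1 + a letters, where
    k - 1 is the number of cuts.  The top letter is not among the a restricted
    ones, so any admissible blocks may be glued back.  If the blocks have
    lengths i_1 - 1, ..., i_k - 1, the word has length i_1 + ... + i_k - 1, so
    the shift by one turns lengths of blocks into the parts of a composition
    of n.  Hence, if f_(m-1) (i) counts the admissible words of length i - 1
    over m - 1 + a letters, then c_m (n, k) counts the words of the theorem,
    and summing over k shows that f_m (n) counts all admissible words of
    length n - 1 over m + a letters.  The induction on m starts with the
    a (a - 1)^(n - 2) words of length n - 1 >= 1 over the a restricted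
    letters.

    Only the first cut is made explicitly.  It gives the recursion
    [marked_words_first] on the side of words, and [composition_sumS], which
    removes the first part of a composition, on the side of the sums.  Both
    word counts are described by transfer recursions on the first letter, with
    the letter that precedes the word as a state, and [card_marked_words]
    relates the second one to sets of tuples. *)

(** * Sums over compositions *)

Section CompositionSum.

Variable R : comNzSemiRingType.
Implicit Type g : nat -> R.

(** The generating function of g over the positive integers, truncated so that
    it is a polynomial. *)
Definition gen_poly g N : {poly R} := \poly_(i < N.+1) (if i is 0 then 0 else g i).

(** Coefficients up to N of a power of a truncated series do not see the
    truncation at N; this is what lets the bound vary with n below. *)
Lemma coef_gen_polyX_trunc g N M k n : (n <= N)%N -> (n <= M)%N ->
  (gen_poly g N ^+ k)`_n = (gen_poly g M ^+ k)`_n.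
Proof.
elim: k n => [|k IHk] n leN leM; first by rewrite !expr0.
rewrite !exprS !coefM; apply: eq_bigr => j _.
have lejn: (j <= n)%N by rewrite -ltnS.
rewrite !coef_poly !ltnS (leq_trans lejn leN) (leq_trans lejn leM).
by rewrite IHk // (leq_trans (leq_subr _ _)).
Qed.

(** Expanding the k-th power over all choices of one monomial per factor gives
    one term per map from 'I_k to exponents; the zero constant coefficient
    discards the maps that take the value 0. *)
Lemma composition_sum_coef g N n k : (n <= N)%N ->
  composition_sum g n k = (gen_poly g N ^+ k)`_n.
Proof.
move=> leN; rewrite (coef_gen_polyX_trunc g k leN (leqnn n)).
rewrite -[in RHS](card_ord k) -prodr_const /gen_poly poly_def bigA_distr_bigA.
rewrite coef_sum /composition_sum big_mkcond; apply: eq_bigr => i _.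
have ->: \prod_(j < k) ((if val (i j) is 0 then 0 else g (i j)) *: 'X^(i j))
  = (\prod_(j < k) (if val (i j) is 0 then 0 else g (i j)))
      *: 'X^(\sum_(j < k) i j) :> {poly R}.
  by rewrite expr_sum scaler_prod.
rewrite coefZ coefXn eq_sym.
case: forallP => /= [i_gt0|/forallP/forallPn[j]].
  have ->: \prod_(j < k) g (i j)
      = \prod_(j < k) (if val (i j) is 0 then 0 else g (i j)).
    by apply: eq_bigr => j _; case: (i j) (i_gt0 j) => [[]].
  by case: (_ == _); rewrite ?mulr1 ?mulr0.
rewrite -eqn0Ngt => /eqP ij0.
by rewrite (bigD1 j) //= ij0 !mul0r.
Qed.

Lemma composition_sum0 g n : composition_sum g n 0 = (n == 0)%:R.
Proof. by rewrite (composition_sum_coef _ _ (leqnn n)) expr0 coef1. Qed.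

(** Cauchy product in the k.+1-st power of the generating function; as its
    constant coefficient vanishes, the first part has the form i.+1. *)
Lemma composition_sumS g n k :
  composition_sum g n k.+1 = \sum_(i < n) g i.+1 * composition_sum g (n - i.+1) k.
Proof.
rewrite (composition_sum_coef _ _ (leqnn n)) exprS coefM big_ord_recl.
rewrite coef_poly /= mul0r add0r; apply: eq_bigr => i _.
rewrite coef_poly /= /bump /= add1n ltnS ltn_ord; congr (_ * _).
by rewrite -composition_sum_coef // leq_subr.
Qed.

End CompositionSum.

(** * Counting words by their first letter *)

Definition admissible a (x y : nat) := ~~ [&& x < a, y < a & x == y]%N.

(** The number of words of length L over the letters below q that may follow
    the letter x.  A state x >= a imposes no condition on the first letter, so
    the state a counts all admissible words. *)
Fixpoint free_words a q x L : nat :=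
  if L is L'.+1 then \sum_(y < q | admissible a x y) free_words a q y L' else 1.

(** The same count for words over the letters below q.+1 with exactly k letters
    q.  For a <= q the letter q may precede and follow any letter; hence the
    second summand is unconditional and restarts from the state a. *)
Fixpoint marked_words a q x L k : nat :=
  if L is L'.+1 then
    \sum_(y < q | admissible a x y) marked_words a q y L' k
      + (if k is k'.+1 then marked_words a q a L' k' else 0)
  else (k == 0).

Lemma admissible_free a x y : (a <= x)%N -> admissible a x y.
Proof. by rewrite /admissible ltnNge => ->. Qed.

Lemma admissible_top a q x : (a <= q)%N -> admissible a x q.
Proof. by rewrite /admissible [(q < a)%N]ltnNge => ->; rewrite andbF. Qed.

Lemma free_words_free a q x L : (a <= x)%N ->
  free_words a q x L = free_words a q a L.
Proof.
by case: L => //= L le_ax; apply: eq_bigl => y; rewrite !admissible_free.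
Qed.

Lemma marked_words_free a q x L k : (a <= x)%N ->
  marked_words a q x L k = marked_words a q a L k.
Proof.
case: L => //= L le_ax; congr addn.
by apply: eq_bigl => y; rewrite !admissible_free.
Qed.

Lemma marked_words0 a q x L : marked_words a q x L 0 = free_words a q x L.
Proof. by elim: L x => //= L IHL x; rewrite addn0; apply: eq_bigr. Qed.

(** Cutting a word at its first letter q: i is the length of the block before
    the cut. *)
Lemma marked_words_first a q x L k :
  marked_words a q x L k.+1
  = (\sum_(i < L) free_words a q x i * marked_words a q a (L.-1 - i) k)%N.
Proof.
elim: L x => [|L IHL] x; first by rewrite big_ord0.
rewrite big_ord_recl /= subn0 mul1n addnC; congr addn.
under eq_bigr => y _ do rewrite IHL.
rewrite exchange_big; apply: eq_bigr => i _ /=.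
by rewrite big_distrl /= /bump /= add1n subnS predn_sub.
Qed.

Lemma marked_words_gt a q x L k : (L < k)%N -> marked_words a q x L k = 0%N.
Proof.
elim: L x k => [|L IHL] x [|k] //= lt_Lk.
by rewrite IHL // big1 // => y _; rewrite IHL // ltnW.
Qed.

(** Forgetting how often q occurs turns the top letter of one level into an
    ordinary unrestricted letter of the next. *)
Lemma sum_marked_words a q x L : (a <= q)%N ->
  (\sum_(k < L.+1) marked_words a q x L k)%N = free_words a q.+1 x L.
Proof.
move=> le_aq; elim: L x => [|L IHL] x; first by rewrite big_ord1.
rewrite /= big_split /= exchange_big /= [RHS]big_mkcond [RHS]big_ord_recr /=.
rewrite -big_mkcond admissible_top // free_words_free // -IHL; congr addn.
  apply: eq_bigr => y _; rewrite big_ord_recr /= IHL -[RHS]addn0; congr addn.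
  by rewrite marked_words_gt.
by rewrite [LHS]big_ord_recl.
Qed.

Lemma free_words_restricted a x L : (x < a)%N ->
  free_words a a x L = (a.-1 ^ L)%N.
Proof.
elim: L x => //= L IHL x lt_xa.
under eq_bigr => y _ do rewrite IHL //.
rewrite sum_nat_const expnS; congr muln.
rewrite -[in RHS](card_ord a) -(cardC1 (Ordinal lt_xa)).
apply: eq_card => y; rewrite !inE unfold_in lt_xa ltn_ord /=.
by rewrite eq_sym.
Qed.

Lemma free_words_initial a n : free_words a a a n.+1 = (a * a.-1 ^ n)%N.
Proof.
rewrite /=; under eq_bigl => y do rewrite admissible_free //.
under eq_bigr => y _ do rewrite free_words_restricted //.
by rewrite sum_nat_const card_ord.
Qed.

(** * Sets of words *)

Lemma card_tupleS (T : finType) L (P : pred (seq T)) :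
  #|[set w : L.+1.-tuple T | P w]|
  = (\sum_x #|[set w : L.-tuple T | P (x :: w)]|)%N.
Proof.
under [RHS]eq_bigr => x _ do rewrite -sum1dep_card.
rewrite -sum1dep_card pair_big_dep /=.
rewrite (reindex (fun p : T * L.-tuple T => [tuple of p.1 :: p.2])) //=.
exists (fun w : L.+1.-tuple T => (thead w, [tuple of behead w])) => [[x w] _|w _].
  by rewrite theadE; congr pair; apply: val_inj.
by rewrite [RHS]tuple_eta.
Qed.

Lemma card_marked_words a q x L k : (a <= q)%N ->
  #|[set w : L.-tuple 'I_q.+1 |
      (count (fun y : 'I_q.+1 => y == q :> nat) w == k)
        && path (admissible a) x (map val w)]|
  = marked_words a q x L k.
Proof.
move=> le_aq; elim: L x k => [|L IHL] x k.
  rewrite /=; case: k => [|k]; last first.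
    by apply: eq_card0 => w; rewrite !inE tuple0.
  rewrite -[RHS](expn0 q.+1) -[in RHS](card_ord q.+1) -card_tuple.
  by apply: eq_card => w; rewrite !inE tuple0.
rewrite (card_tupleS L (fun w => (count (fun y : 'I_q.+1 => y == q :> nat) w == k)
        && path (admissible a) x (map val w))).
rewrite big_ord_recr /= eqxx admissible_top //=; congr addn.
  rewrite big_mkcond [RHS]big_mkcond /=; apply: eq_bigr => y _.
  case: ifP => _; last by apply: eq_card0 => w; rewrite !inE andbF.
  rewrite -IHL; apply: eq_card => w.
  by rewrite !inE (ltn_eqF (ltn_ord y)).
case: k => [|k].
  by apply: eq_card0 => w; rewrite !inE.
rewrite -(marked_words_free q L k le_aq) -IHL.
by apply: eq_card => w; rewrite !inE.
Qed.

(** * Words and compositions *)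

(** Both sides satisfy the recursion of the first cut: a first part i.+1 is a
    first block of length i, and the letter q after it accounts for one more
    position, so n.+1 - i.+1 = n - i leaves a word of length n.-1 - i. *)
Lemma composition_sum_marked_words (R : comNzSemiRingType) (g : nat -> R) a q n k :
    (forall i, g i.+1 = (free_words a q a i)%:R) ->
  composition_sum g n.+1 k.+1 = (marked_words a q a n k)%:R.
Proof.
move=> gE; elim: k n => [|k IHk] n; rewrite composition_sumS big_ord_recr /=.
  rewrite subnn composition_sum0 mulr1 gE marked_words0 big1 ?add0r // => i _.
  by rewrite composition_sum0 subn_eq0 ltnS leqNgt ltn_ord mulr0.
rewrite subnn composition_sumS big_ord0 mulr0 addr0.
rewrite marked_words_first natr_sum; apply: eq_bigr => i _.
case: n i => [[]//|n] i.
have ->: (n.+2 - i.+1 = (n - i).+1)%N by rewrite subSS subSn // -ltnS.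
by rewrite IHk gE natrM.
Qed.

(** Each step of f_ adds one unrestricted letter: the one at which words are
    cut. *)
Lemma f_free_words (R : comNzSemiRingType) (f0 : nat -> R) a m n :
    (forall i, f0 i.+1 = (free_words a a a i)%:R) ->
  f_ f0 m n.+1 = (free_words a (m + a) a n)%:R.
Proof.
move=> f0E; elim: m n => [|m IHm] n; first exact: f0E.
rewrite addSn -sum_marked_words ?leq_addl // natr_sum /= big_add1 big_mkord.
by apply: eq_bigr => k _; apply: composition_sum_marked_words.
Qed.

Theorem corollary2 (a m : nat) (ha : (1 <= a)%N) (hm : (1 <= m)%N)
    (f0 : nat -> int)
    (hf1 : f0 1%N = 1)
    (hf2 : f0 2%N = a%:Z)
    (hfrec : forall n : nat, (1 <= n)%N ->
       f0 (n + 2)%N = (a%:Z - 1) * f0 (n + 1)%N)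
    (n k : nat) (hk : (1 <= k)%N) (hkn : (k <= n)%N) :
  c_ f0 m n k = #|words a m n k|%:Z.
Proof.
have f0E i : f0 i.+1 = (free_words a a a i)%:R.
  case: i => [|i]; first by rewrite hf1.
  rewrite free_words_initial; elim: i => [|i IHi]; first by rewrite hf2 muln1 natz.
  have /= := hfrec i.+1 isT; rewrite addn2 addn1 IHi => ->.
  have ->: a%:Z - 1 = a.-1%:R by rewrite -[in LHS](prednK ha) -natz mulrSr addrK.
  by rewrite expnS mulnCA [RHS]natrM.
case: m hm => // m _; case: n hkn => [|n] hkn; first by case: k hk hkn.
case: k hk hkn => // k _ _.
rewrite /c_ (@composition_sum_marked_words _ _ a (m + a)); last first.
  by move=> i; apply: f_free_words.
rewrite natz -card_marked_words ?leq_addl //; congr (Posz _).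
rewrite /words subn1 /= addSn !subn1 /=.
apply: eq_card => w; rewrite !inE; congr (_ && _).
rewrite /no_equal_adjacent_below.
have -> s : path (admissible a) a s = sorted (admissible a) s.
  by case: s => //= y s; rewrite admissible_free.
by rewrite sorted_map.
Qed.
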